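(* Let $(\Omega,\mathcal A,\mu,d)$ be a metric measure space equipped with a doubling Borel probability measure $\mu$. Let $\{E_i\}_{i\in\mathbb N}$ be a sequence of open subsets of $\Omega$ and let $E_\infty:=\limsup_{i\to\infty}E_i=\bigcap_{t=1}^\infty\bigcup_{i=t}^\infty E_i$. Then $$\mu(E_\infty)=1$$ if and only if there exists a constant $C>0$ such that for any ball $B$ centred in $\operatorname{supp}\mu$ there is a sequence $\{L_{i,B}\}_{i\in\mathbb N}$ of (possibly empty) finite unions of disjoint balls centred in $\operatorname{supp}\mu$, with $L_{i,B}\subset E_i\cap B$ for all $i$, such that $$\sum_{i=1}^\infty\mu(L_{i,B})=\infty$$ and, for infinitely many $Q\in\mathbb N$, $$\sum_{s,t=1}^Q\mu(L_{s,B}\cap L_{t,B})\le\frac{C}{\mu(B)}\left(\sum_{s=1}^Q\mu(L_{s,B})\right)^2 .$$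
   Context: $(\Omega,d)$ is a metric space, $\mathcal A$ is a $\sigma$-algebra on $\Omega$ containing all Borel sets, and $\mu$ is a probability measure on $\mathcal A$. $\operatorname{supp}\mu$ denotes the support of $\mu$, i.e. the smallest closed set of full $\mu$-measure. For $x\in\Omega$ and $r>0$, $B(x,r)=\{y\in\Omega: d(x,y)<r\}$ is the ball centred at $x$ of radius $r$; a ball always comes with a prescribed centre and radius. The measure $\mu$ is doubling if there are constants $\lambda\ge1$ and $r_0>0$ such that $\mu(B(x,2r))\le\lambda\,\mu(B(x,r))$ for all $x\in\operatorname{supp}\mu$ and $0<r<r_0$. *)

(* Defs.v *)
From HB Require Import structures.
From mathcomp Require Import all_boot all_order all_algebra.
From mathcomp Require Import all_classical all_reals all_analysis.

Set Implicit Arguments.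
Unset Strict Implicit.
Unset Printing Implicit Defensive.

Import Order.TTheory GRing.Theory Num.Theory.
Import numFieldNormedType.Exports.

Local Open Scope classical_set_scope.
Local Open Scope ring_scope.

(* The two structures are independent here: that the sigma-algebra contains
   the Borel sets is the separate predicate contains_borel. *)
#[short(type="measurableMetricType")]
HB.structure Definition MeasurableMetric d (R : numDomainType) :=
  {T of Measurable d T & Metric R T}.

Definition contains_borel d (R : realType) (T : measurableMetricType d R) :=
  <<s [set U : set T | open U] >> `<=` (measurable : set (set T)).

(* S = supp mu, the smallest closed set of full measure. In a nonseparable
   space there may be no such set, so this is a predicate and not a function. *)
Definition is_support d (R : realType) (T : measurableMetricType d R)
    (mu : set T -> \bar R) (S : set T) :=
  [/\ closed S, mu S = 1%E &
      forall F : set T, closed F -> mu F = 1%E -> S `<=` F].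

Definition doubling d (R : realType) (T : measurableMetricType d R)
    (mu : set T -> \bar R) (S : set T) :=
  exists lambda r0 : R, [/\ 1 <= lambda, 0 < r0 &
    forall x r, S x -> 0 < r < r0 ->
      (mu (ball x (2 * r)) <= lambda%:E * mu (ball x r))%E].

(* The union is empty when n = 0. The values of c and r at indices k >= n are
   irrelevant. *)
Definition finite_disjoint_ball_union (R : realType) (T : metricType R)
    (S L : set T) :=
  exists (n : nat) (c : nat -> T) (r : nat -> R),
    [/\ forall k, (k < n)%N -> S (c k) /\ 0 < r k,
        trivIset `I_n (fun k => ball (c k) (r k)) &
        L = \bigcup_(k < n) ball (c k) (r k)].

(* Main.v *)
Require Import Defs.
From HB Require Import structures.
From mathcomp Require Import all_boot all_order all_algebra.
From mathcomp Require Import all_classical all_reals all_analysis.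
From mathcomp Require Import finmap measurable_realfun ring lra.

Set Implicit Arguments.
Unset Strict Implicit.
Unset Printing Implicit Defensive.

Import Order.TTheory GRing.Theory Num.Theory.
Import numFieldNormedType.Exports.

Local Open Scope classical_set_scope.
Local Open Scope ring_scope.

(* If the criterion holds, the second moment method gives
   mu (E_oo `&` B) >= mu B / C for every ball B centred in the support. If the
   limsup set E_oo were not of full measure, some closed K, the part of the
   support outside a tail union of the E_i, would have positive mass. A fixed
   proportion of the mass of K is carried by disjoint balls of arbitrarily small
   radius centred in K, and a fixed proportion of these balls lies in E_oo,
   hence off K: this contradicts the shrinking of the neighbourhoods of K to K.

   Conversely, if E_oo has full measure, then for every n some finite block
   E_n, ..., E_(N-1) covers half of B, and the points whose ball of a small
   common radius fits in one E_i `&` B still have mass at least mu B / 2. A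
   packing by such balls gives pairwise disjoint L_n, ..., L_(N-1) of total mass
   at least mu B / (4 lambda). Concatenate such blocks: with A the sum of the
   mu (L_i) over the first k blocks, the double sum is at most k A, because each
   block is disjoint, and k mu B <= 4 lambda A. *)

(** * Real-valued masses of events and a second moment inequality *)

Section fine_probability.
Context d (T : measurableType d) (R : realType) (P : probability T R).
Implicit Types A B U : set T.

Lemma probability_fineK A : measurable A -> (fine (P A))%:E = P A.
Proof. by move=> mA; rewrite fineK ?fin_num_measure. Qed.

Lemma le_fine_probability A B : measurable A -> measurable B -> A `<=` B ->
  fine (P A) <= fine (P B).
Proof.
move=> mA mB AB; rewrite -lee_fin !probability_fineK//.
by apply: le_measure => //; exact: mem_set.
Qed.

Lemma fine_probabilityD A B : measurable A -> measurable B -> B `<=` A ->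
  fine (P (A `\` B)) = fine (P A) - fine (P B).
Proof.
move=> mA mB BA; apply: EFin_inj.
rewrite EFinB !probability_fineK//; last exact: measurableD.
have PA : (P A < +oo)%E by rewrite -probability_fineK// ltry.
by rewrite measureD// setIidr.
Qed.

Lemma fine_probabilityIr A B : measurable A -> measurable B -> P B = 1%E ->
  fine (P (A `&` B)) = fine (P A).
Proof.
move=> mA mB PB; have mAB := measurableI _ _ mA mB.
apply/eqP; rewrite eq_le le_fine_probability//=.
rewrite -lee_fin !probability_fineK//.
rewrite [leLHS](measureDI _ mA mB) -[leRHS]add0e leeD2r//.
have : (P (~` B) <= 0)%E by rewrite probability_setC// PB subee.
apply: le_trans; rewrite setDE; apply: le_measure; last exact: subIsetr.
  by rewrite mem_set//; apply: measurableI => //; exact: measurableC.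
by rewrite mem_set//; exact: measurableC.
Qed.

Lemma fine_probability_bigcup_fset (I : choiceType) (X : {fset I})
    (F : I -> set T) :
  (forall i, i \in X -> measurable (F i)) -> trivIset [set` X] F ->
  fine (P (\bigcup_(i in [set` X]) F i)) = \sum_(i <- X) fine (P (F i)).
Proof.
move=> mF tF; rewrite bigcup_fset measure_fbigsetU// big_seq_cond.
rewrite [RHS]big_seq_cond sum_fine// => i /andP[iX _].
by rewrite fin_num_measure//; exact: mF.
Qed.

Lemma fine_probability_bigsetU_le (I : eqType) (s : seq I) (F : I -> set T) :
  (forall i, i \in s -> measurable (F i)) ->
  fine (P (\big[setU/set0]_(i <- s) F i)) <= \sum_(i <- s) fine (P (F i)).
Proof.
elim: s => [_|i s IH mF]; first by rewrite !big_nil measure0.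
have mi : measurable (F i) by apply: mF; rewrite mem_head.
have ms j : j \in s -> measurable (F j).
  by move=> js; apply: mF; rewrite inE js orbT.
have mU : measurable (\big[setU/set0]_(j <- s) F j).
  by rewrite big_seq; apply: bigsetU_measurable.
rewrite !big_cons -lee_fin EFinD !probability_fineK//; last exact: measurableU.
apply: le_trans (measureU2 _ mi mU) _.
by rewrite leeD2l//; move: (IH ms); rewrite -lee_fin probability_fineK.
Qed.

Lemma nondecreasing_probability_gt (F : (set T)^nat) (a : R) :
  (forall i, measurable (F i)) -> nondecreasing_seq F ->
  a < fine (P (\bigcup_n F n)) -> exists n, a < fine (P (F n)).
Proof.
move=> mF ndF aF.
have mU : measurable (\bigcup_n F n) by exact: bigcup_measurable.
have : P (F n) @[n --> \oo] --> P (\bigcup_n F n).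
  exact: nondecreasing_cvg_mu.
rewrite -(probability_fineK mU) => /fine_cvg/cvgr_gt/(_ _ aF)[n _ /(_ n)].
by move=> /(_ (leqnn n)) ?; exists n.
Qed.

Lemma nonincreasing_probability_lt (F : (set T)^nat) (a : R) :
  (forall i, measurable (F i)) -> nonincreasing_seq F ->
  fine (P (\bigcap_n F n)) < a -> exists n, fine (P (F n)) < a.
Proof.
move=> mF niF aF.
have mI : measurable (\bigcap_n F n).
  by apply: bigcap_measurable => //; exists 0%N.
have F0 : (P (F 0%N) < +oo)%E by rewrite -probability_fineK// ltry.
have : P (F n) @[n --> \oo] --> P (\bigcap_n F n).
  exact: nonincreasing_cvg_mu.
rewrite -(probability_fineK mI) => /fine_cvg/cvgr_lt/(_ _ aF)[n _ /(_ n)].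
by move=> /(_ (leqnn n)) ?; exists n.
Qed.

(* Integrate [2 c f <= f ^+ 2 + c ^+ 2 * \1_U], where [f] counts the sets
   [L s] that contain a given point. *)
Lemma second_moment_ge (I : eqType) (L : I -> set T) (r : seq I) U (c : R) :
  (forall s, measurable (L s)) -> measurable U ->
  (forall s, s \in r -> L s `<=` U) -> 0 <= c ->
  2 * c * \sum_(s <- r) fine (P (L s)) <=
  \sum_(s <- r) \sum_(t <- r) fine (P (L s `&` L t)) + c ^+ 2 * fine (P U).
Proof.
move=> mL mU LU c0.
have mLL s t : measurable (L s `&` L t) by exact: measurableI.
have intE A : measurable A -> (fine (P A))%:E = (\int[P]_x (\1_A x)%:E)%E.
  by move=> mA; rewrite probability_fineK// integral_indic// setIT.
have mi A : measurable A ->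
    measurable_fun [set: T] (fun x => (\1_A x : R)%:E : \bar R).
  by move=> mA; apply/measurable_EFinP; exact: measurable_indic.
have i0 A x : (0 <= (\1_A x : R)%:E)%E by rewrite lee_fin indicE.
have ms (f : I -> set T) : (forall s, measurable (f s)) ->
    measurable_fun [set: T]
      (fun x => \sum_(s <- r) (\1_(f s) x : R)%:E : \bar R)%E.
  by move=> mf; apply: emeasurable_sum => s; exact: mi.
have s0 (f : I -> set T) x : (0 <= \sum_(s <- r) (\1_(f s) x : R)%:E)%E.
  by apply: sume_ge0.
rewrite -lee_fin.
have -> : (2 * c * \sum_(s <- r) fine (P (L s)))%:E =
    (\int[P]_x ((2 * c)%:E * \sum_(s <- r) (\1_(L s) x)%:E))%E.
  rewrite ge0_integralZl_EFin//; [|exact: ms|exact: mulr_ge0].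
  rewrite ge0_integral_sum//; last by move=> s; exact: mi.
  rewrite EFinM -sumEFin; congr (_ * _)%E.
  by apply: eq_bigr => s _; rewrite intE.
have -> : (\sum_(s <- r) \sum_(t <- r) fine (P (L s `&` L t))
      + c ^+ 2 * fine (P U))%:E =
    (\int[P]_x ((\sum_(s <- r) \sum_(t <- r) (\1_(L s `&` L t) x)%:E)
      + (c ^+ 2)%:E * (\1_U x)%:E))%E.
  rewrite ge0_integralD//; last first.
  - by apply: measurable_funeM; exact: mi.
  - by move=> x _; rewrite mule_ge0// lee_fin sqr_ge0.
  - by apply: emeasurable_sum => s; apply: ms.
  - by move=> x _; apply: sume_ge0.
  rewrite ge0_integralZl_EFin ?sqr_ge0//; last exact: mi.
  rewrite ge0_integral_sum//; last by move=> s; exact: ms.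
  rewrite EFinD EFinM -intE// -sumEFin; congr (_ + _)%E; apply: eq_bigr => s _.
  rewrite ge0_integral_sum//; last by move=> t; exact: mi.
  by rewrite -sumEFin; apply: eq_bigr => t _; rewrite intE.
apply: ge0_le_integral => //.
- by move=> x _; rewrite mule_ge0// lee_fin mulr_ge0.
- by apply: measurable_funeM; exact: ms.
- apply: emeasurable_funD; last by apply: measurable_funeM; exact: mi.
  by apply: emeasurable_sum => s; apply: ms.
move=> x _ /=; rewrite sumEFin.
under eq_bigr do rewrite sumEFin.
rewrite sumEFin -!EFinM -EFinD lee_fin.
set f := \sum_(s <- r) \1_(L s) x.
have -> : \sum_(s <- r) \sum_(t <- r) \1_(L s `&` L t) x = f ^+ 2.
  rewrite expr2 /f mulr_suml; apply: eq_bigr => s _; rewrite mulr_sumr.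
  by apply: eq_bigr => t _; rewrite indicI.
(* On [U] the inequality is [0 <= (f - c) ^+ 2]; off [U] the count [f] vanishes, since every [L s]
   lies in [U]. *)
have [xU|xU] := boolP (x \in U).
  rewrite indicE xU mulr1 -subr_ge0.
  have -> : f ^+ 2 + c ^+ 2 - 2 * c * f = (f - c) ^+ 2 by ring.
  exact: sqr_ge0.
suff -> : f = 0 by rewrite mulr0 expr0n add0r mulr_ge0 ?sqr_ge0// indicE.
rewrite /f big_seq big1// => s sr; rewrite indicE memNset// => /(LU _ sr).
by rewrite notin_setE in xU.
Qed.
End fine_probability.

(** * A Kochen-Stone lower bound for the mass of a limsup set *)

Lemma infinite_set_nat_ge (A : set nat) (N : nat) :
  infinite_set A -> exists2 k, A k & (N <= k)%N.
Proof.
move=> infA; apply: contrapT => noN; apply: infA.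
apply: sub_finite_set (finite_II N) => k Ak /=.
by rewrite ltnNge; apply/negP => Nk; apply: noN; exists k.
Qed.

Section kochen_stone.
Context d (T : measurableType d) (R : realType) (P : probability T R).
Variable L : (set T)^nat.
Hypothesis mL : forall i, measurable (L i).

Let A (Q : nat) := \sum_(0 <= s < Q) fine (P (L s)).

Let A_le (M N : nat) : (M <= N)%N -> A M <= A N.
Proof.
move=> MN; rewrite /A [leRHS](big_cat_nat _ (n := M))//= lerDl.
by rewrite sumr_ge0// => i _; exact: fine_ge0.
Qed.

Lemma probability_series_pinftyP :
  (\sum_(0 <= i <oo) P (L i) = +oo)%E <-> forall M : R, exists Q, M < A Q.
Proof.
have AE Q : (\sum_(0 <= i < Q) P (L i))%E = (A Q)%:E.
  by rewrite /A -sumEFin; apply: eq_bigr => i _; rewrite probability_fineK.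
split=> [Loo M|AM].
- apply: contrapT => /forallNP AM.
  suff : (\sum_(0 <= i <oo) P (L i) <= M%:E)%E by rewrite Loo leye_eq.
  apply: lime_le; first exact: is_cvg_nneseries.
  by apply: nearW => Q /=; rewrite AE lee_fin leNgt; apply/negP/AM.
- apply/eqP; rewrite -leye_eq leNgt; apply/negP => Loo.
  have Lfin : (\sum_(0 <= i <oo) P (L i))%E \is a fin_num.
    by rewrite ge0_fin_numE// nneseries_ge0.
  have [Q] := AM (fine (\sum_(0 <= i <oo) P (L i))%E).
  apply/negP; rewrite -leNgt -lee_fin fineK// -AE.
  exact: nneseries_lim_ge.
Qed.

(** Otherwise some tail union of the [L j], [j >= n], has mass [u < K^-1]. The second moment
    inequality for [L n, ..., L (Q - 1)] inside this union then bounds [A Q] for all admissible [Q],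
    against divergence of the series. *)
Lemma kochen_stone (K : R) : 0 < K ->
  (\sum_(0 <= i <oo) P (L i) = +oo)%E ->
  infinite_set [set Q : nat |
    \sum_(0 <= s < Q) \sum_(0 <= t < Q) fine (P (L s `&` L t))
    <= K * (\sum_(0 <= s < Q) fine (P (L s))) ^+ 2] ->
  1 <= K * fine (P (lim_sup_set L)).
Proof.
move=> K0 /probability_series_pinftyP Loo infQ; rewrite leNgt; apply/negP.
rewrite -ltr_pdivlMl// mulr1 => limL.
have mU n : measurable (\bigcup_(j >= n) L j) by exact: bigcup_measurable.
have [|n un] := nonincreasing_probability_lt mU _ limL.
  move=> i j ij; apply/subsetPset => x [k /= jk Lk].
  by exists k => //=; exact: leq_trans jk.
set u := fine _ in un.
have u0 : 0 <= u by rewrite fine_ge0.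
have Ku : 0 < 1 - K * u by rewrite subr_gt0 -ltr_pdivlMl// mulr1.
(* This threshold is the bound on [A Q] that the second moment inequality yields below. *)
have [Q0 AQ0] := Loo (2 * A n / (1 - K * u)).
have [Q /= QP] := infinite_set_nat_ge (maxn n Q0) infQ.
rewrite geq_max => /andP[nQ Q0Q].
have {AQ0} : 2 * A n < A Q * (1 - K * u).
  by rewrite -ltr_pdivrMr//; apply: lt_le_trans AQ0 (A_le Q0Q).
have An0 : 0 <= A n by rewrite sumr_ge0// => i _; exact: fine_ge0.
move=> AQ; have AQ0 : 0 < A Q.
  by rewrite -(pmulr_lgt0 _ Ku); apply: le_lt_trans AQ; rewrite mulr_ge0.
have tail (F : nat -> R) : (forall i, 0 <= F i) ->
    \sum_(n <= s < Q) F s <= \sum_(0 <= s < Q) F s.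
  by move=> F0; rewrite [leRHS](big_cat_nat _ (n := n))//= lerDr sumr_ge0.
(* The best weight is about [A Q / u]; taking [K^-1] for [u] gives [c = K * A Q]. *)
have := @second_moment_ge _ _ _ P _ L (index_iota n Q) (\bigcup_(j >= n) L j)
  (K * A Q) mL (mU n) _ (mulr_ge0 (ltW K0) (ltW AQ0)).
have -> : \sum_(n <= s < Q) fine (P (L s)) = A Q - A n.
  by rewrite /A [X in _ = X - _](big_cat_nat _ (n := n))//= addrAC subrr add0r.
rewrite -/u leNgt => /(_ _)/negP; apply.
  by move=> s; rewrite mem_index_iota => /andP[ns _] x Lx; exists s.
rewrite (@le_lt_trans _ _ (K * A Q ^+ 2 + (K * A Q) ^+ 2 * u))//.
  (* Terms are nonnegative, so the double sum over [n <= s, t < Q] is at most the one over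
     [0 <= s, t < Q], which the choice of [Q] controls. *)
  rewrite lerD2r (le_trans _ QP)// (le_trans (tail _ _))//.
    by move=> s; rewrite sumr_ge0// => t _; exact: fine_ge0.
  by apply: ler_sum => s _; apply: tail => t; exact: fine_ge0.
rewrite -subr_gt0.
have -> : 2 * (K * A Q) * (A Q - A n) - (K * A Q ^+ 2 + (K * A Q) ^+ 2 * u) =
  K * A Q * (A Q * (1 - K * u) - 2 * A n) by ring.
by rewrite !mulr_gt0// subr_gt0.
Qed.

End kochen_stone.

(** * Topology of metric balls and finite disjoint unions of them *)

Lemma metric_ball_open (R : realFieldType) (T : metricType R) (x : T) (r : R) :
  open (ball x r).
Proof.
rewrite openE => y; rewrite ballEmdist /= => xy.
have ryx : 0 < r - mdist x y by rewrite subr_gt0.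
apply: filterS (nbhsx_ballx y _ ryx) => z; rewrite !ballEmdist /= => yz.
by rewrite (le_lt_trans (metric_triangle x y z))// addrC -ltrBrDr.
Qed.

(** A point of [ball x r] also lies in the ball of radius [r] about every centre close enough to
    [x]. This makes the set of centres whose ball fits in [G] measurable. *)
Lemma closed_ball_subset (R : realFieldType) (T : metricType R) (G : set T)
    (r : R) :
  closed [set x | ball x r `<=` G].
Proof.
rewrite closedE => x /= nG y; rewrite ballEmdist /= => xy.
apply: contrapT => Gy; apply: nG.
have rxy : 0 < r - mdist x y by rewrite subr_gt0.
apply: filterS (nbhsx_ballx x _ rxy) => z; rewrite ballEmdist /= => xz zG.
apply/Gy/zG; rewrite ballEmdist /= (le_lt_trans (metric_triangle z x y))//.
by rewrite (metric_sym z) -ltrBrDr.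
Qed.

Lemma finite_disjoint_ball_union_fset (R : realType) (T : metricType R)
    (S : set T) (x0 : T) (X : {fset T}) (r : R) :
  0 < r -> [set` X] `<=` S -> trivIset [set` X] (fun x => ball x r) ->
  finite_disjoint_ball_union S (\bigcup_(x in [set` X]) ball x r).
Proof.
(* [x0] is the default centre at indices past the end of the enumeration of [X], which may be
   empty. *)
move=> r_gt0 XS tX; exists #|` X|, (nth x0 X), (fun=> r); split.
- by move=> k kX; split=> //; apply: XS; exact: mem_nth.
- move=> i j /= iX jX /(tX _ _ (mem_nth x0 iX) (mem_nth x0 jX)) /eqP.
  by rewrite nth_uniq ?fset_uniq// => /eqP.
- apply/seteqP; split=> y [].
    move=> x xX xy; exists (index x X); first by rewrite /= index_mem.
    by rewrite nth_index.
  by move=> k kX ky; exists (nth x0 X k) => //; exact: mem_nth.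
Qed.

(** * Borel measurability, balls centred in the support, and packings *)

Section metric_measure_space.
Context d (R : realType) (T : measurableMetricType d R) (P : probability T R).
Variable S : set T.
Hypothesis borelT : contains_borel T.
Hypothesis suppS : is_support P S.

Lemma open_measurable_borel (U : set T) : open U -> measurable U.
Proof. by move=> oU; apply: borelT; exact: sub_sigma_algebra. Qed.

Lemma closed_measurable_borel (U : set T) : closed U -> measurable U.
Proof.
move=> /closed_openC/open_measurable_borel/measurableC.
by rewrite setCK.
Qed.

Lemma measurable_metric_ball (x : T) (r : R) : measurable (ball x r).
Proof. exact/open_measurable_borel/metric_ball_open. Qed.

Lemma support_closed : closed S. Proof. by case: suppS. Qed.

Lemma measurable_support : measurable S.
Proof. exact/closed_measurable_borel/support_closed. Qed.

(** The complement of a null ball would be a closed set of full measure, hence would contain the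
    support and with it [x]. *)
Lemma support_ball_gt0 (x : T) (r : R) :
  S x -> 0 < r -> 0 < fine (P (ball x r)).
Proof.
move=> Sx r0; rewrite lt_neqAle fine_ge0// andbT; apply/negP => /eqP P0.
have mb := measurable_metric_ball x r.
case: suppS => _ _ /(_ (~` ball x r)) /(_ _ _ x Sx); apply.
- exact/open_closedC/metric_ball_open.
- by rewrite probability_setC// -(probability_fineK P mb) -P0 sube0.
- exact: ballxx.
Qed.

Lemma doubling_fine : doubling P S -> exists lambda r0 : R,
  [/\ 1 <= lambda, 0 < r0 & forall x r, S x -> 0 < r < r0 ->
    fine (P (ball x (2 * r))) <= lambda * fine (P (ball x r))].
Proof.
move=> [lambda [r0 [lambda1 r00 dbl]]].
exists lambda, r0; split=> // x r Sx rr0.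
rewrite -lee_fin EFinM !probability_fineK; [|exact: measurable_metric_ball..].
exact: dbl.
Qed.

(* A maximal family of disjoint balls of radius [r] centred in [A] need not be
   finite, but only finitely many of its members have mass above a given
   positive threshold; their doubles increase to a cover of [A]. *)
Lemma ball_packing (lambda r : R) (A : set T) :
  0 < r -> 0 <= lambda ->
  (forall x, A x ->
     fine (P (ball x (2 * r))) <= lambda * fine (P (ball x r))) ->
  measurable A -> A `<=` S ->
  exists X : {fset T}, [/\ [set` X] `<=` A,
    trivIset [set` X] (fun x => ball x r) &
    fine (P A) <= 2 * lambda * \sum_(x <- X) fine (P (ball x r))].
Proof.
move=> r0 lambda0 dbl mA AS.
(* The null case is separate because half of [P A] must be strictly below [P A] later. *)
have [A0|An0] := eqVneq (fine (P A)) 0.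
  exists fset0; split; first by move=> x; rewrite /= inE.
    by move=> x y; rewrite /= inE.
  by rewrite A0 big_nil mulr0.
have PA : 0 < fine (P A) by rewrite lt_neqAle eq_sym An0 fine_ge0.
have [D [DA tD maxD]] :=
  ex_maximal_disjoint_subcollection (fun x => ball x r) A.
pose N k := [set x | D x /\ k.+1%:R^-1 <= fine (P (ball x r))].
have ND k : N k `<=` D by move=> x [].
have mball x s : measurable (ball x s : set T) by exact: measurable_metric_ball.
(* Otherwise [k + 2] disjoint balls of mass at least [1 / (k + 1)] would have total mass above 1. *)
have finN k : finite_set (N k).
  apply: contrapT => /(@infinite_set_fset _ _ k.+2)[B BN kB].
  have tB : trivIset [set` B] (fun x => ball x r).
    by apply: sub_trivIset tD => x /BN/ND.
  have : fine (P (\bigcup_(x in [set` B]) ball x r)) <= 1.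
    rewrite -lee_fin probability_fineK ?probability_le1//.
    - by apply: fin_bigcup_measurable.
    - by apply: fin_bigcup_measurable.
  rewrite fine_probability_bigcup_fset//; apply/negP; rewrite -ltNge.
  apply: (@lt_le_trans _ _ (\sum_(x <- B) k.+1%:R^-1)); last first.
    rewrite big_seq [leRHS]big_seq; apply: ler_sum => x xB.
    by have [] := BN x xB.
  rewrite big_const_seq count_predT iter_addr_0 -[ltRHS]mulr_natl.
  rewrite ltr_pdivlMr ?ltr0n//.
  by rewrite mul1r ltr_nat.
pose G k := A `&` \bigcup_(x in N k) ball x (2 * r).
have mG k : measurable (G k).
  apply: measurableI => //; apply: open_measurable_borel.
  by apply: bigcup_open => x _; exact: metric_ball_open.
have ndG : nondecreasing_seq G.
  move=> i j ij; apply/subsetPset => x [Ax [y [Dy yi] xy]]; split=> //.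
  exists y => //; split=> //; apply: le_trans yi.
  by rewrite lef_pV2 ?posrE ?ltr0n// ler_nat.
have GA : \bigcup_k G k = A.
  apply/seteqP; split=> [x [k _ []]//|x Ax].
  (* If [x] were in no double ball, [ball x r] would miss all balls of the family, and adding [x] to
     [D] would contradict maximality. *)
  have [y Dy xy] : exists2 y, D y & ball y (2 * r) x.
    apply: contrapT => noy.
    have nDx : ~ D x.
      by move=> Dx; apply: noy; exists x => //; apply: ballxx; rewrite mulr_gt0.
    apply: (maxD (x |` D)).
    - split; first by move=> y Dy; right.
      by move=> /(_ x); apply: contra_not nDx => h; apply: h; left.
    - by move=> z [->|/DA].
    - have disj z : D z -> ball z r `&` ball x r !=set0 -> False.
        move=> Dz [w [zw xw]]; apply: noy; exists z => //.
        by rewrite mulr_natl; exact: ball_triangle zw (ball_sym xw).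
      move=> y z [->|Dy] [->|Dz]//; last exact: tD.
      + by rewrite setIC => /(disj _ Dz).
      + by move=> /(disj _ Dy).
  have [k kP] : exists k, k.+1%:R^-1 < fine (P (ball y r)).
    have := near_infty_natSinv_lt
      (PosNum (support_ball_gt0 (AS _ (DA _ Dy)) r0)).
    by move=> [k _ /(_ k (leqnn k)) /= ?]; exists k.
  by exists k => //; split=> //; exists y => //; split=> //; exact: ltW.
(* Stopping at a finite stage loses at most half of [A], whence the factor 2 in the conclusion;
   [lambda] comes from replacing double balls by balls. *)
have [k kG] : exists k, fine (P A) / 2 < fine (P (G k)).
  apply: nondecreasing_probability_gt => //.
  by rewrite GA ltr_pdivrMr// ltr_pMr// ltr1n.
exists (fset_set (N k)); split.
- by rewrite fset_setK// => x /ND/DA.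
- by rewrite fset_setK//; apply: sub_trivIset tD; exact: ND.
rewrite -mulrA [leRHS]mulrC -ler_pdivrMr// (le_trans (ltW kG))//.
apply: (@le_trans _ _
  (fine (P (\big[setU/set0]_(x <- fset_set (N k)) ball x (2 * r))))).
  apply: le_fine_probability => //.
    by rewrite -bigcup_fset; exact: fin_bigcup_measurable.
  by rewrite -bigcup_fset fset_setK// => x [].
apply: le_trans (fine_probability_bigsetU_le _ _) _ => //.
rewrite mulr_sumr big_seq [leRHS]big_seq; apply: ler_sum => x.
by rewrite in_fset_set// => /set_mem xN; apply/dbl/DA/(ND k).
Qed.

End metric_measure_space.

(** * Limsup sets of open sets under a doubling measure *)

Section doubling_measure.
Context d (R : realType) (T : measurableMetricType d R) (P : probability T R).
Variables (S : set T) (lambda r0 : R).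
Hypothesis borelT : contains_borel T.
Hypothesis suppS : is_support P S.
Hypotheses (lambda1 : 1 <= lambda) (r0_gt0 : 0 < r0).
Hypothesis dbl : forall x r, S x -> 0 < r < r0 ->
  fine (P (ball x (2 * r))) <= lambda * fine (P (ball x r)).
Variable E : (set T)^nat.
Hypothesis oE : forall i, open (E i).

Let lambda0 : 0 < lambda. Proof. exact: lt_le_trans lambda1. Qed.

Let open_tail n : open (\bigcup_(j >= n) E j).
Proof. exact: bigcup_open. Qed.

Let mE i : measurable (E i). Proof. exact: open_measurable_borel. Qed.

Let mtail n : measurable (\bigcup_(j >= n) E j).
Proof. exact: open_measurable_borel. Qed.

Let mlim : measurable (lim_sup_set E).
Proof. by apply: bigcap_measurable => //; exists 0%N. Qed.

Let mS : measurable S. Proof. exact: measurable_support borelT suppS. Qed.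

Let mball (x : T) (r : R) : measurable (ball x r).
Proof. exact: measurable_metric_ball. Qed.

(** This does the work of a density theorem at a single scale [rho]: the packing puts mass at least
    [P K / (2 lambda C)] into [V i] off [K], while the choice of [i] leaves less than that there. *)
Lemma lim_sup_set_full (C : R) : 0 < C ->
  (forall x r, S x -> 0 < r ->
     fine (P (ball x r)) <= C * fine (P (lim_sup_set E `&` ball x r))) ->
  P (lim_sup_set E) = 1%E.
Proof.
move=> C0 loc; rewrite -probability_fineK//; congr EFin.
apply/eqP; rewrite eq_le -lee_fin probability_fineK// probability_le1//=.
rewrite leNgt; apply/negP => /nonincreasing_probability_lt[//||n].
  move=> i j ij; apply/subsetPset => x [k /= jk Ek].
  by exists k => //=; exact: leq_trans jk.
set U := \bigcup_(j >= n) E j => PU.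
pose K := ~` U `&` S.
have mU : measurable U by exact: mtail.
have cK : closed K.
  by apply: closedI; [exact/open_closedC/open_tail|exact: support_closed suppS].
have mK : measurable K by exact: closed_measurable_borel.
have PK : 0 < fine (P K).
  rewrite /K fine_probabilityIr//; [|exact: measurableC..|by case: suppS].
  rewrite -lte_fin probability_fineK; last exact: measurableC.
  by rewrite probability_setC// sube_gt0 -(probability_fineK P mU) lte_fin.
pose V k := \bigcup_(x in K) ball x (k.+1%:R^-1 : R).
have mV k : measurable (V k).
  apply: open_measurable_borel => //.
  by apply: bigcup_open => x _; exact: metric_ball_open.
have niV : nonincreasing_seq V.
  move=> i j ij; apply/subsetPset => x [y Ky xy]; exists y => //.
  by apply: le_ball xy; rewrite lef_pV2 ?posrE ?ltr0n// ler_nat.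
have KV k : K `<=` V k.
  by move=> x Kx; exists x => //; apply: ballxx; rewrite invr_gt0 ltr0n.
have VK : \bigcap_k V k = K.
  apply/seteqP; split=> [x Vx|x Kx k _]; last exact: KV.
  (* Closedness of [K] matters here: a point off [K] has a whole ball off [K], so it leaves [V k]
     for large [k]. *)
  apply: contrapT => nKx; have oKC := closed_openC cK.
  have /nbhs_ballP[e /= e0 eK] : nbhs x (~` K) by exact: open_nbhs_nbhs.
  have [k _ /(_ k (leqnn k)) /= ke] := near_infty_natSinv_lt (PosNum e0).
  have [y Ky xy] := Vx k I.
  by apply: (eK y) Ky; apply: le_ball (ball_sym xy); exact: ltW.
have lC : 0 < 2 * lambda * C by rewrite !mulr_gt0.
have [k kV] : exists k, fine (P (V k)) < fine (P K) * (1 + (2 * lambda * C)^-1).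
  apply: nonincreasing_probability_lt => //.
  by rewrite VK ltr_pMr// ltrDl invr_gt0.
(* The larger index meets both demands: [rho < r0], so that doubling applies, and [V i] inside
   [V k]. *)
have [k0 _ /(_ (maxn k k0) (leq_maxr _ _)) /= rho0] :=
  near_infty_natSinv_lt (PosNum r0_gt0).
set i := maxn k k0 in rho0; set rho : R := i.+1%:R^-1 in rho0.
have rho_gt0 : 0 < rho by rewrite invr_gt0 ltr0n.
have {kV} : fine (P (V i)) < fine (P K) * (1 + (2 * lambda * C)^-1).
  apply: le_lt_trans kV; apply: le_fine_probability => //.
  by apply/subsetPset/niV; exact: leq_maxl.
apply/negP; rewrite -leNgt.
have [|X [XK tX PKX]] := ball_packing borelT suppS rho_gt0 (ltW lambda0) _
    mK (@subIsetr _ _ _).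
  by move=> x [_ Sx]; apply: dbl => //; rewrite rho_gt0.
have : fine (P K) <= 2 * lambda * C * fine (P (V i `\` K)).
  apply: (le_trans PKX); rewrite -[leRHS]mulrA ler_pM2l ?mulr_gt0//.
  have mI x : measurable (lim_sup_set E `&` ball x rho) by exact: measurableI.
  apply: (@le_trans _ _
    (C * \sum_(x <- X) fine (P (lim_sup_set E `&` ball x rho)))).
    rewrite mulr_sumr big_seq [leRHS]big_seq; apply: ler_sum => x xX.
    by apply: loc => //; have [] := XK x xX.
  rewrite ler_pM2l// -fine_probability_bigcup_fset//; last first.
    exact: trivIset_setIl.
  apply: le_fine_probability; [|exact: measurableD|].
    by apply: fin_bigcup_measurable.
  (* The centres lie in [K], so the balls lie in [V i]; a limsup point lies in the tail union [U],
     hence off [K]. *)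
  move=> y [x xX [Ey xy]]; split; first by exists x => //; exact: XK.
  by move=> [nUy _]; apply: nUy; exact: Ey.
rewrite fine_probabilityD//.
rewrite -ler_pdivrMl// mulrDr mulr1 [_ * _^-1]mulrC; lra.
Qed.

(** The start [n] is arbitrary so that blocks can be chained. In [4 * lambda], one factor 2 pays for
    keeping only half of [B], and [2 * lambda] is the cost of the packing. *)
Lemma disjoint_ball_block (x : T) (r : R) (n : nat) :
  P (lim_sup_set E) = 1%E -> S x -> 0 < r ->
  exists N (L : (set T)^nat),
    [/\ (n < N)%N, forall i, finite_disjoint_ball_union S (L i),
        forall i, L i `<=` E i `&` ball x r, trivIset setT L &
        fine (P (ball x r)) <= 4 * lambda * \sum_(n <= i < N) fine (P (L i))].
Proof.
move=> PE Sx r_gt0; set B := ball x r; have mB : measurable B by exact: mball.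
have PB : 0 < fine (P B) by exact: (support_ball_gt0 borelT suppS).
pose U := \bigcup_(j >= n) E j; have mU : measurable U by exact: mtail.
have PBU : fine (P (B `&` U)) = fine (P B).
  apply: fine_probabilityIr => //; apply/eqP; rewrite eq_le probability_le1//=.
  by rewrite -PE; exact: lim_sup_set_ub.
pose W k := B `&` \bigcup_(j in [set j | n <= j <= n + k]%N) E j.
have oW k : open (W k).
  by apply: openI; [exact: metric_ball_open|exact: bigcup_open].
have mW k : measurable (W k) by exact: open_measurable_borel.
have [k kW] : exists k, fine (P B) / 2 < fine (P (W k)).
  apply: nondecreasing_probability_gt => //.
    move=> i j ij; apply/subsetPset => y [By [l /= /andP[nl li] Ey]].
    split=> //; exists l => //=; rewrite nl (leq_trans li)//.
    by rewrite leq_add2l.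
  have -> : \bigcup_k W k = B `&` U.
    apply/seteqP; split=> y.
      by move=> [k _ [By [j /= /andP[nj _] Ey]]]; split=> //; exists j.
    move=> [By [j /= nj Ey]]; exists j => //; split=> //; exists j => //=.
    by rewrite nj leq_addl.
  by rewrite PBU ltr_pdivrMr// ltr_pMr// ltr1n.
pose N := (n + k).+1.
(* A common radius lets one packing serve all indices of the block at once; restricting to [S] makes
   doubling available at the centres. *)
pose V l := \bigcup_(j in [set j | n <= j <= n + k]%N)
  [set y | ball y (l.+1%:R^-1 : R) `<=` E j `&` B] `&` S.
have mV l : measurable (V l).
  apply: measurableI => //; apply: bigcup_measurable => j _.
  by apply: closed_measurable_borel => //; exact: closed_ball_subset.
have ndV : nondecreasing_seq V.
  move=> i j ij; apply/subsetPset => y [[l nl yl] Sy]; split=> //.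
  exists l => // z yz; apply: yl; apply: le_ball yz.
  by rewrite lef_pV2 ?posrE ?ltr0n// ler_nat.
have VW : \bigcup_l V l = W k `&` S.
  apply/seteqP; split=> y.
    move=> [l _ [[j nj yj] Sy]]; split=> //.
    have [Ey By] : (E j `&` B) y by apply/yj/ballxx; rewrite invr_gt0 ltr0n.
    by split=> //; exists j.
  move=> [[By [j nj Ey]] Sy].
  have /nbhs_ballP[e /= e0 eEB] : nbhs y (E j `&` B).
    apply: open_nbhs_nbhs; split=> //.
    by apply: openI => //; exact: metric_ball_open.
  have [l _ /(_ l (leqnn l)) /= le] := near_infty_natSinv_lt (PosNum e0).
  exists l => //; split=> //; exists j => // z yz; apply: eEB.
  by apply: le_ball yz; exact: ltW.
have [l lV] : exists l, fine (P B) / 2 < fine (P (V l)).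
  apply: nondecreasing_probability_gt => //.
  by rewrite VW fine_probabilityIr//; case: suppS.
have [l0 _ /(_ (maxn l l0) (leq_maxr _ _)) /= rho0] :=
  near_infty_natSinv_lt (PosNum r0_gt0).
set i := maxn l l0 in rho0; set rho : R := i.+1%:R^-1 in rho0.
have rho_gt0 : 0 < rho by rewrite invr_gt0 ltr0n.
have {}lV : fine (P B) / 2 < fine (P (V i)).
  apply: (lt_le_trans lV); apply: le_fine_probability => //.
  by apply/subsetPset/ndV; exact: leq_maxl.
have [|X [XV tX PVX]] := ball_packing borelT suppS rho_gt0 (ltW lambda0) _
    (mV i) (@subIsetr _ _ _).
  by move=> y [_ Sy]; apply: dbl => //; rewrite rho_gt0.
(* Each ball of the packing is assigned to a single index [j] with [E j] containing it. The [L j]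
   are therefore pairwise disjoint, and empty outside the block. *)
have /choice[idx idxP] : forall y, exists j, y \in X ->
    (n <= j < N)%N /\ ball y rho `<=` E j `&` B.
  move=> y; have [yX|] := boolP (y \in X); last by exists 0%N.
  by have [[j nj yj] _] := XV y yX; exists j.
pose X_ j := [fset y in X | idx y == j]%fset.
have XX j : [set` X_ j] `<=` [set` X] by move=> y /=; rewrite !inE => /andP[].
pose L j := \bigcup_(y in [set` X_ j]) ball y rho.
have mL j : measurable (L j).
  apply: open_measurable_borel => //.
  by apply: bigcup_open => y _; exact: metric_ball_open.
exists N, L; split.
- by rewrite /N ltnS leq_addr.
- move=> j; apply: (finite_disjoint_ball_union_fset x rho_gt0).
    by move=> y /XX/XV[].
  exact: sub_trivIset tX.
- move=> j z [y]; rewrite /= !inE => /andP[yX /eqP <-].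
  by have [_ h] := idxP y yX; exact: h.
- move=> j1 j2 _ _ [z [[y1 + yz1] [y2 + yz2]]].
  rewrite /= !inE => /andP[yX1 /eqP <-] /andP[yX2 /eqP <-].
  by rewrite (tX y1 y2 yX1 yX2)//; exists z.
have XL :
    \sum_(y <- X) fine (P (ball y rho)) <= \sum_(n <= j < N) fine (P (L j)).
  rewrite -fine_probability_bigcup_fset//.
  apply: le_trans (fine_probability_bigsetU_le _ _); last by [].
  apply: le_fine_probability.
  - by apply: fin_bigcup_measurable.
  - exact: bigsetU_measurable.
  move=> z [y yX yz]; have [nyN _] := idxP y yX.
  rewrite -bigcup_seq; exists (idx y); first by rewrite /= mem_index_iota.
  by exists y => //; rewrite /= !inE eqxx andbT.
rewrite -(ler_pM2l (_ : 0 < 2 * lambda)) ?mulr_gt0// in XL.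
lra.
Qed.

End doubling_measure.

(** * Cutting the indices into consecutive blocks *)

Section block_start.
Variable tau : nat -> nat.
Hypothesis tau_gt : forall n, (n < tau n)%N.

(** The left end of the block containing [i], when the blocks start at 0, [tau 0], [tau (tau 0)] and
    so on. The recursion carries the current start along, so no block number has to be searched
    for. *)
Fixpoint block_start (i : nat) : nat :=
  if i is i'.+1 then
    if i == tau (block_start i') then i else block_start i'
  else 0%N.

Lemma iter_block_lt k : (iter k tau 0 < iter k.+1 tau 0)%N.
Proof. exact: tau_gt. Qed.

Lemma block_startE k i : (iter k tau 0 <= i < iter k.+1 tau 0)%N ->
  block_start i = iter k tau 0.
Proof.
have inside m : block_start m = m ->
    forall j, (m + j < tau m)%N -> block_start (m + j) = m.
  move=> mE; elim=> [|j IH]; first by rewrite addn0.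
  rewrite addnS => jm; rewrite /= IH; last exact: ltnW.
  by rewrite ltn_eqF.
suff start : block_start (iter k tau 0) = iter k tau 0.
  move=> /andP[ki ik]; rewrite -(subnKC ki).
  by apply: inside; rewrite // subnKC.
elim: k {i} => [//|k IH].
have := iter_block_lt k; rewrite iterS; set m := iter k tau 0 in IH *.
(* [p] is the last index of the block that starts at [m]; its successor [tau m] opens the next
   one. *)
case tauE : (tau m) => [//|p]; rewrite ltnS => mp /=.
suff -> : block_start p = m by rewrite tauE eqxx.
by rewrite -(subnKC mp); apply: inside; rewrite // subnKC// tauE.
Qed.

End block_start.

(** * Divergence and quasi-independence of the concatenated blocks *)

Section blocks.
Context d (T : measurableType d) (R : realType) (P : probability T R).
Variables (tau : nat -> nat) (M : nat -> (set T)^nat) (B : set T) (c : R).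
Hypothesis tau_gt : forall n, (n < tau n)%N.
Hypothesis mM : forall n i, measurable (M n i).
Hypothesis tM : forall n, trivIset setT (M n).
Hypotheses (c0 : 0 < c) (PB : 0 < fine (P B)).
Hypothesis PM : forall n,
  fine (P B) <= c * \sum_(n <= i < tau n) fine (P (M n i)).

Let L i := M (block_start tau i) i.
Let t k := iter k tau 0%N.

Let t_le k : (t k <= t k.+1)%N. Proof. exact/ltnW/iter_block_lt. Qed.

Let blockE k (F : set T -> R) :
  \sum_(t k <= i < t k.+1) F (L i) = \sum_(t k <= i < tau (t k)) F (M (t k) i).
Proof.
rewrite big_nat [RHS]big_nat; apply: eq_bigr => i ki.
by rewrite /L (block_startE tau_gt ki).
Qed.

Let sum_le k : k%:R * fine (P B) <= c * \sum_(0 <= i < t k) fine (P (L i)).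
Proof.
elim: k => [|k IH]; first by rewrite mul0r big_geq// mulr0.
rewrite (big_cat_nat _ (n := t k))//= mulrDr -natr1 mulrDl mul1r lerD//.
by rewrite (blockE k (fun A => fine (P A))).
Qed.

(* Each block is a disjoint family, so it meets [A] in mass at most [P A]. *)
Let sumI_le k (A : set T) : measurable A ->
  \sum_(0 <= i < t k) fine (P (A `&` L i)) <= k%:R * fine (P A).
Proof.
move=> mA; elim: k => [|k IH]; first by rewrite mul0r big_geq.
rewrite (big_cat_nat _ (n := t k))//= -natr1 mulrDl mul1r lerD//.
rewrite (blockE k (fun D => fine (P (A `&` D)))).
pose X : {fset nat} := [fset i | i in index_iota (t k) (tau (t k))]%fset.
(* The index interval is turned into a finite set so that additivity over disjoint finite families
   applies. *)
have -> : \sum_(t k <= i < tau (t k)) fine (P (A `&` M (t k) i)) =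
    \sum_(i <- X) fine (P (A `&` M (t k) i)).
  apply: perm_big; apply: uniq_perm; rewrite ?iota_uniq ?fset_uniq// => i.
  by rewrite !inE.
have mI i : measurable (A `&` M (t k) i) by exact: measurableI.
rewrite -fine_probability_bigcup_fset//; last first.
  move=> i j _ _ [y [[_ yi] [_ yj]]].
  by apply: (tM (n := t k)) => //; exists y.
apply: le_fine_probability => //; first by apply: fin_bigcup_measurable.
by move=> x [i _ []].
Qed.

Lemma block_series_pinfty : (\sum_(0 <= i <oo) P (L i) = +oo)%E.
Proof.
apply/probability_series_pinftyP => [i|a]; first exact: mM.
(* After more than [a'] blocks, each of mass at least [P B / c], the partial sum exceeds [a]. *)
pose a' := c * `|a| / fine (P B).
exists (t (Num.truncn a').+1).
rewrite -(ltr_pM2l c0); apply: lt_le_trans (sum_le _).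
rewrite -ltr_pdivrMr//; apply: le_lt_trans (truncnS_gt _).
by rewrite ler_pM2r ?invr_gt0// ler_pM2l// ler_norm.
Qed.

(** Every block end [Q = t k] satisfies the inequality, and [t] is injective; finiteness would pull
    back along [t] to finiteness of [nat]. *)
Lemma block_quasi_independent : infinite_set [set Q : nat |
  \sum_(0 <= s < Q) \sum_(0 <= i < Q) fine (P (L s `&` L i))
  <= c / fine (P B) * (\sum_(0 <= s < Q) fine (P (L s))) ^+ 2].
Proof.
move=> fin; apply: infinite_nat.
have tmono : {homo t : k l / (k < l)%N}.
  apply: homo_ltn => [? ? ?|k]; first exact: ltn_trans.
  exact: (iter_block_lt tau_gt).
have tinj : injective t.
  by move=> k l tkl; case: (ltngtP k l) => // /tmono; rewrite tkl ltnn.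
apply: sub_finite_set (finite_preimage _ fin) => [k _ /=|]; last first.
  by move=> k l _ _; exact: tinj.
set a := \sum_(0 <= s < t k) fine (P (L s)).
have a0 : 0 <= a by rewrite sumr_ge0// => i _; exact: fine_ge0.
(* [sumI_le] with [A := L s], summed over [s], gives the first bound; [sum_le] then replaces [k] by
   [c * a / P B]. *)
apply: (@le_trans _ _ (k%:R * a)).
  by rewrite mulr_sumr; apply: ler_sum => s _; apply/sumI_le/mM.
by rewrite expr2 mulrA ler_wpM2r// mulrAC ler_pdivlMr.
Qed.

End blocks.

(** * The equivalence, with sums in the extended reals *)

Theorem theorem2 (R : realType) (d : measure_display)
    (Omega : measurableMetricType d R) (mu : probability Omega R)
    (suppmu : set Omega) (E : nat -> set Omega)
    (borel_Omega : contains_borel Omega)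
    (suppmuP : is_support mu suppmu)
    (mu_doubling : doubling mu suppmu)
    (E_open : forall i, open (E i)) :
  mu (lim_sup_set E) = 1%E <->
  exists2 C : R, 0 < C &
    forall (x : Omega) (r : R), suppmu x -> 0 < r ->
    exists L : nat -> set Omega,
      [/\ forall i, finite_disjoint_ball_union suppmu (L i),
          forall i, L i `<=` E i `&` ball x r,
          (\sum_(0 <= i <oo) mu (L i) = +oo)%E &
          infinite_set [set Q : nat |
            (\sum_(s < Q) \sum_(t < Q) mu (L s `&` L t)
             <= (C / fine (mu (ball x r)))%:E
                * (\sum_(s < Q) mu (L s)) ^+ 2)%E]].
Proof.
have [lambda [r0 [lambda1 r0_gt0 dbl]]] :=
  doubling_fine borel_Omega mu_doubling.
have mball (x : Omega) r : measurable (ball x r).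
  exact: measurable_metric_ball.
have union_measurable L : finite_disjoint_ball_union suppmu L -> measurable L.
  by move=> [n [c [r [_ _ ->]]]]; apply: bigcup_measurable.
(* All masses are finite, so the inequality between extended reals is the one between real sums used
   so far. *)
have setE (L : (set Omega)^nat) (K : R) : (forall i, measurable (L i)) ->
    [set Q : nat | (\sum_(s < Q) \sum_(t < Q) mu (L s `&` L t)
       <= K%:E * (\sum_(s < Q) mu (L s)) ^+ 2)%E] =
    [set Q : nat | \sum_(0 <= s < Q) \sum_(0 <= t < Q) fine (mu (L s `&` L t))
       <= K * (\sum_(0 <= s < Q) fine (mu (L s))) ^+ 2].
  move=> mL; apply: eq_set => Q.
  have mLL s t : measurable (L s `&` L t) by exact: measurableI.
  rewrite -lee_fin EFinM EFin_expe !big_mkord -!sumEFin.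
  congr (_ <= _ * _ ^+ 2)%E.
    apply: eq_bigr => s _; rewrite big_mkord -sumEFin.
    by apply: eq_bigr => t _; rewrite probability_fineK.
  by apply: eq_bigr => s _; rewrite probability_fineK.
split=> [mu1|[C C0 quasi]].
  have lambda0 : 0 < lambda by exact: lt_le_trans lambda1.
  exists (4 * lambda); first by rewrite mulr_gt0.
  move=> x r Sx r_gt0.
  have /choice[tau /choice[M ML]] := fun n => disjoint_ball_block borel_Omega
    suppmuP lambda1 r0_gt0 dbl E_open n mu1 Sx r_gt0.
  have mM n i : measurable (M n i).
    by have [_ h _ _ _] := ML n; exact: union_measurable.
  have tau_gt n : (n < tau n)%N by have [] := ML n.
  have tM n : trivIset setT (M n) by have [] := ML n.
  have PM n : fine (mu (ball x r)) <=
      4 * lambda * \sum_(n <= i < tau n) fine (mu (M n i)) by have [] := ML n.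
  have PB := support_ball_gt0 borel_Omega suppmuP Sx r_gt0.
  have c0 : 0 < 4 * lambda by rewrite mulr_gt0.
  exists (fun i => M (block_start tau i) i); split.
  - by move=> i; have [_ + _ _ _] := ML (block_start tau i).
  - by move=> i; have [_ _ + _ _] := ML (block_start tau i).
  - exact: block_series_pinfty c0 PB PM.
  have := block_quasi_independent tau_gt mM tM PB PM.
  by rewrite -setE//; move=> i; exact: mM.
apply: (lim_sup_set_full borel_Omega suppmuP lambda1 r0_gt0 dbl E_open C0).
move=> x r Sx r_gt0.
have PB := support_ball_gt0 borel_Omega suppmuP Sx r_gt0.
have [L [unionL LEB Loo quasiL]] := quasi x r Sx r_gt0.
have mL i : measurable (L i) by exact: union_measurable.
have := quasiL; rewrite setE// => {}quasiL.
(* With [K = C / mu B] this bounds [mu B] by [C] times the mass of the limsup of the [L i], a subset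
   of the limsup of the [E i] within [B]. *)
have := kochen_stone mL (divr_gt0 C0 PB) Loo quasiL.
rewrite mulrAC ler_pdivlMr// mul1r => /le_trans; apply.
rewrite ler_pM2l//; apply: le_fine_probability.
- by apply: bigcap_measurable => [|n _]; [exists 0%N|exact: bigcup_measurable].
- apply: measurableI => //.
  apply: bigcap_measurable => [|n _]; first by exists 0%N.
  by apply: open_measurable_borel => //; exact: bigcup_open.
move=> y Ly; split; last by have [i _ /LEB[]] := Ly 0%N I.
by move=> n _; have [i ni /LEB[Ei _]] := Ly n I; exists i.
Qed.
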